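(* Let $\mathbb{F}$ be a field of characteristic different from two. Let $(\mathcal{P},\circ,\{\cdot,\cdot\})$ be a simple transposed Poisson algebra or a simple transposed Poisson superalgebra over $\mathbb{F}$ whose bracket $\{\cdot,\cdot\}$ is not identically zero and such that $\mathcal{P}\circ\mathcal{P}=\mathcal{P}$. Then the Kantor double $\mathfrak{J}(\mathcal{P})$ is simple.
   Context: A transposed Poisson superalgebra is a $\mathbb{Z}_2$-graded vector space $\mathcal{P}=\mathcal{P}_0\oplus\mathcal{P}_1$ with two grading-compatible multiplications: an associative supercommutative multiplication $\circ$ (not necessarily unital) and a Lie superalgebra bracket $\{\cdot,\cdot\}$ (that is, $\{x,y\}=-(-1)^{|x||y|}\{y,x\}$ and $(-1)^{|x||z|}\{\{x,y\},z\}+(-1)^{|y||x|}\{\{y,z\},x\}+(-1)^{|z||y|}\{\{z,x\},y\}=0$) such that $2x\circ\{y,z\}=\{x\circ y,z\}+(-1)^{|x||y|}\{y,x\circ z\}$ for all homogeneous $x,y,z$, where $|x|$ is the parity of $x$. A transposed Poisson algebra is the case $\mathcal{P}_1=0$. $\mathcal{P}$ is simple if it contains no proper nonzero $\mathbb{Z}_2$-graded subspace $\mathcal{I}$ with $\mathcal{I}\circ\mathcal{P}\subset\mathcal{I}$ and $\{\mathcal{I},\mathcal{P}\}\subset\mathcal{I}$. $\mathcal{P}\circ\mathcal{P}$ is the linear span of all products. Kantor double: let $\mathcal{P}^s=\{x^s:x\in\mathcal{P}\}$ be a copy of the vector space $\mathcal{P}$ with opposite parity, so $x^s$ has parity $|x|+1$.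 $\mathfrak{J}(\mathcal{P})=\mathcal{P}\oplus\mathcal{P}^s$ has even part $\mathcal{P}_0\oplus\mathcal{P}_1^s$, odd part $\mathcal{P}_1\oplus\mathcal{P}_0^s$, and bilinear multiplication given for homogeneous $x,y\in\mathcal{P}$ by $x*y=x\circ y$, $x^s*y=(x\circ y)^s$, $x*y^s=(-1)^{|x|}(x\circ y)^s$, $x^s*y^s=(-1)^{|x|}\{x,y\}$. A superalgebra is simple if it contains no proper nonzero $\mathbb{Z}_2$-graded ideals. *)

(* Defs.v *)
From HB Require Import structures.
From mathcomp Require Import all_boot all_algebra all_classical.

Set Implicit Arguments.
Unset Strict Implicit.
Unset Printing Implicit Defensive.

Import GRing.Theory.
Local Open Scope ring_scope.
Local Open Scope classical_set_scope.

(* A Z_2-graded vector space is the (external) direct sum of two arbitrary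
   vector spaces; no finiteness of the dimension is assumed.  An element of it
   is the pair (even component, odd component). *)
Record superspace (F : fieldType) := Superspace {
  even_part : lmodType F;
  odd_part : lmodType F
}.

Definition sspace (F : fieldType) (V : superspace F) : lmodType F :=
  (even_part V * odd_part V)%type.
Coercion sspace : superspace >-> GRing.Lmodule.type.

Section Superspaces.
Variables (F : fieldType) (V : superspace F).

Definition even_comp (x : V) : even_part V := x.1.
Definition odd_comp (x : V) : odd_part V := x.2.

(* Parities are booleans, with [false] = even, [true] = odd and addition [(+)].
   Zero is homogeneous of both parities. *)
Definition homog (i : bool) : set V :=
  [set x | if i then even_comp x = 0 else odd_comp x = 0].

(* (-1)^(ij) as a scalar *)
Definition ksign (i j : bool) : F := (-1) ^+ (i && j).

Definition subspace (I : set V) : Prop :=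
  I 0 /\ forall (a : F) x y, I x -> I y -> I (a *: x + y).

Definition graded_subspace (I : set V) : Prop :=
  subspace I /\ forall x, I x -> I (even_comp x, 0) /\ I (0, odd_comp x).

Definition lspan (S : set V) : set V :=
  [set x | forall I, subspace I -> S `<=` I -> I x].

Definition grading_compatible (m : V -> V -> V) : Prop :=
  forall i j x y, homog i x -> homog j y -> homog (i (+) j) (m x y).

Definition super_comm (m : V -> V -> V) : Prop :=
  forall i j x y, homog i x -> homog j y -> m x y = ksign i j *: m y x.

Definition super_anticomm (b : V -> V -> V) : Prop :=
  forall i j x y, homog i x -> homog j y -> b x y = - (ksign i j *: b y x).

Definition super_jacobi (b : V -> V -> V) : Prop :=
  forall i j k x y z, homog i x -> homog j y -> homog k z ->
    ksign i k *: b (b x y) z + ksign j i *: b (b y z) x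
      + ksign k j *: b (b z x) y = 0.

Definition transposed_leibniz (m b : V -> V -> V) : Prop :=
  forall i j k x y z, homog i x -> homog j y -> homog k z ->
    2%:R *: m x (b y z) = b (m x y) z + ksign i j *: b y (m x z).

End Superspaces.

Record superalgebra (F : fieldType) := Superalgebra {
  sa_space :> superspace F;
  sa_mul : {bilinear sa_space -> sa_space -> sa_space};
  sa_graded : grading_compatible sa_mul
}.

Definition graded_ideal (F : fieldType) (A : superalgebra F) (I : set A) :=
  graded_subspace I /\
  forall x y, I x -> I (sa_mul A x y) /\ I (sa_mul A y x).

Definition simple_superalgebra (F : fieldType) (A : superalgebra F) : Prop :=
  forall I : set A, graded_ideal I -> I = [set 0] \/ I = setT.

(* Transposed Poisson algebras are the case where [odd_part] is zero. *)
Record transposed_poisson (F : fieldType) := TransposedPoisson {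
  tp_space :> superspace F;
  tp_mul : {bilinear tp_space -> tp_space -> tp_space};
  tp_bracket : {bilinear tp_space -> tp_space -> tp_space};
  tp_mul_graded : grading_compatible tp_mul;
  tp_mulA : associative tp_mul;
  tp_mulC : super_comm tp_mul;
  tp_bracket_graded : grading_compatible tp_bracket;
  tp_bracketC : super_anticomm tp_bracket;
  tp_jacobi : super_jacobi tp_bracket;
  tp_leibniz : transposed_leibniz tp_mul tp_bracket
}.

Definition tp_ideal (F : fieldType) (P : transposed_poisson F) (I : set P) :=
  graded_subspace I /\
  forall x y, I x -> I (tp_mul P x y) /\ I (tp_bracket P x y).

Definition simple_transposed_poisson (F : fieldType)
    (P : transposed_poisson F) : Prop :=
  forall I : set P, tp_ideal I -> I = [set 0] \/ I = setT.

Definition tp_square (F : fieldType) (P : transposed_poisson F) : set P :=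
  lspan [set z | exists x y, z = tp_mul P x y].
Arguments tp_square {F} P _.

Section KantorDouble.
Variables (F : fieldType) (P : transposed_poisson F).

(* even part P_0 + P_1^s, odd part P_1 + P_0^s *)
Definition kantor_space : superspace F :=
  Superspace (even_part P * odd_part P)%type (odd_part P * even_part P)%type.

(* the copy of x in the summand P, and the copy x^s in the summand P^s *)
Definition kin (x : P) : kantor_space :=
  ((even_comp x, 0), (odd_comp x, 0)).
Definition kshift (x : P) : kantor_space :=
  ((0, odd_comp x), (0, even_comp x)).

(* [u = kin (kfst u) + kshift (ksnd u)], see [kantor_decomp] *)
Definition kfst (u : kantor_space) : P :=
  ((even_comp u).1, (odd_comp u).1).
Definition ksnd (u : kantor_space) : P :=
  ((odd_comp u).2, (even_comp u).2).

(* x |-> (-1)^|x| x, extended linearly *)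
Definition parity_aut (x : P) : P := (even_comp x, - odd_comp x).

(* The bilinear extension of the product given on homogeneous elements by
   [kantor_mul_in_in], ..., [kantor_mul_shift_shift] *)
Definition kantor_mul (u v : kantor_space) : kantor_space :=
  kin (tp_mul P (kfst u) (kfst v)
       + tp_bracket P (parity_aut (ksnd u)) (ksnd v))
  + kshift (tp_mul P (ksnd u) (kfst v)
       + tp_mul P (parity_aut (kfst u)) (ksnd v)).

Lemma kin_linear : linear kin.
Proof.
move=> a x y; congr (_, _); congr (_, _) => //=; by rewrite scaler0 addr0.
Qed.

Lemma kshift_linear : linear kshift.
Proof.
move=> a x y; congr (_, _); congr (_, _) => //=; by rewrite scaler0 addr0.
Qed.

Lemma kfst_linear : linear kfst. Proof. by []. Qed.

Lemma ksnd_linear : linear ksnd. Proof. by []. Qed.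

Lemma parity_aut_linear : linear parity_aut.
Proof.
by move=> a x y; congr (_, _); rewrite /= /odd_comp /= opprD scalerN.
Qed.

HB.instance Definition _ := GRing.isLinear.Build F P kantor_space *:%R kin
  kin_linear.
HB.instance Definition _ := GRing.isLinear.Build F P kantor_space *:%R kshift
  kshift_linear.
HB.instance Definition _ := GRing.isLinear.Build F kantor_space P *:%R kfst
  kfst_linear.
HB.instance Definition _ := GRing.isLinear.Build F kantor_space P *:%R ksnd
  ksnd_linear.
HB.instance Definition _ := GRing.isLinear.Build F P P *:%R parity_aut
  parity_aut_linear.

Lemma kantor_mul_bilinear : bilinear_for *:%R *:%R kantor_mul.
Proof.
have comb (U : lmodType F) (a : F) (x y z t : U) :
    (a *: x + y) + (a *: z + t) = a *: (x + z) + (y + t).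
  by rewrite addrACA scalerDr.
split=> [v a u w | u a v w]; rewrite /kantor_mul.
- rewrite kfst_linear ksnd_linear !parity_aut_linear !linearPl /=.
  by rewrite !comb kin_linear kshift_linear comb.
- rewrite kfst_linear ksnd_linear !linearPr /=.
  by rewrite !comb kin_linear kshift_linear comb.
Qed.

HB.instance Definition _ :=
  bilinear_isBilinear.Build F kantor_space kantor_space kantor_space
    *:%R *:%R kantor_mul kantor_mul_bilinear.

Lemma kantor_decomp (u : kantor_space) : u = kin (kfst u) + kshift (ksnd u).
Proof.
case: u => [[a b] [c d]]; congr (_, _); congr (_, _);
  by rewrite /= ?addr0 ?add0r.
Qed.

Lemma kin_homog i (x : P) : homog i x -> homog i (kin x).
Proof. by case: i; rewrite /homog /= /even_comp /odd_comp /= => ->. Qed.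

Lemma kshift_homog i (x : P) : homog i x -> homog (~~ i) (kshift x).
Proof. by case: i; rewrite /homog /= /even_comp /odd_comp /= => ->. Qed.

Lemma kfst_homog i (u : kantor_space) : homog i u -> homog i (kfst u).
Proof. by case: i; rewrite /homog /= /even_comp /odd_comp /= => ->. Qed.

Lemma ksnd_homog i (u : kantor_space) : homog i u -> homog (~~ i) (ksnd u).
Proof. by case: i; rewrite /homog /= /even_comp /odd_comp /= => ->. Qed.

Lemma parity_aut_homog i (x : P) :
  homog i x -> parity_aut x = (-1) ^+ i *: x.
Proof.
case: x => x0 x1; case: i; rewrite /homog /= /even_comp /odd_comp /= => ->.
  by rewrite expr1 scaleN1r; congr (_, _); rewrite /= oppr0.
by rewrite expr0 scale1r /parity_aut /even_comp /odd_comp /= oppr0.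
Qed.

Lemma kfst_kin x : kfst (kin x) = x. Proof. by case: x. Qed.
Lemma ksnd_kin x : ksnd (kin x) = 0. Proof. by []. Qed.
Lemma kfst_kshift x : kfst (kshift x) = 0. Proof. by []. Qed.
Lemma ksnd_kshift x : ksnd (kshift x) = x. Proof. by case: x. Qed.

Definition kE := (kfst_kin, ksnd_kin, kfst_kshift, ksnd_kshift).

Lemma kantor_mul_in_in x y : kantor_mul (kin x) (kin y) = kin (tp_mul P x y).
Proof. by rewrite /kantor_mul !kE !(linear0, linear0l, linear0r, addr0, add0r). Qed.

Lemma kantor_mul_shift_in x y :
  kantor_mul (kshift x) (kin y) = kshift (tp_mul P x y).
Proof. by rewrite /kantor_mul !kE !(linear0, linear0l, linear0r, addr0, add0r). Qed.

Lemma kantor_mul_in_shift i x y : homog i x ->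
  kantor_mul (kin x) (kshift y) = (-1) ^+ i *: kshift (tp_mul P x y).
Proof.
move=> hx; rewrite /kantor_mul !kE (parity_aut_homog hx).
by rewrite !(linear0, linear0l, linear0r, addr0, add0r) linearZl_LR /= linearZ.
Qed.

Lemma kantor_mul_shift_shift i x y : homog i x ->
  kantor_mul (kshift x) (kshift y) = (-1) ^+ i *: kin (tp_bracket P x y).
Proof.
move=> hx; rewrite /kantor_mul !kE (parity_aut_homog hx).
by rewrite !(linear0, linear0l, linear0r, addr0, add0r) linearZl_LR /= linearZ.
Qed.

Lemma kantor_mul_graded : grading_compatible kantor_mul.
Proof.
have hD (V : superspace F) k (x y : V) : homog k x -> homog k y ->
    homog k (x + y).
  by case: k; case: x y => [x0 x1] [y0 y1];
     rewrite /homog /= /even_comp /odd_comp /= => -> ->; rewrite addr0.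
have hp k x : homog k x -> homog k (parity_aut x).
  by case: k; rewrite /homog /= /even_comp /odd_comp /= => ->; rewrite ?oppr0.
move=> i j u v hu hv.
have [hu1 hu2] := (kfst_homog hu, ksnd_homog hu).
have [hv1 hv2] := (kfst_homog hv, ksnd_homog hv).
have hm := @tp_mul_graded _ P; have hb := @tp_bracket_graded _ P.
apply: (hD).
  apply: kin_homog; apply: (hD); first exact: hm.
  by have := hb _ _ _ _ (hp _ _ hu2) hv2; rewrite addbN addNb negbK.
rewrite -[i (+) j]negbK; apply: kshift_homog; apply: (hD).
  by rewrite -addNb; exact: hm.
by rewrite -addbN; apply: hm => //; exact: hp.
Qed.

Definition kantor_double : superalgebra F :=
  Superalgebra kantor_mul_graded.

End KantorDouble.

(* Main.v *)
Require Import Defs.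
From mathcomp Require Import all_boot all_algebra all_classical.

(** The theorem holds because an ideal I of the Kantor double is caught between
    two pairs of subspaces of P, its sections (A, B), with A = {x | x in I} and
    B = {y | y^s in I}, and its projections (A', B') to P and P^s, and both
    pairs satisfy
      P A <= A,  P A <= B,  P B <= B,  {P, B} <= A.
    Lemma [kantor_pair_trivial] shows that such a pair is (0, 0) or (P, P):

    - [kantor_pair_bracket]: {P, B} <= B.  Modulo B the left side of the
      transposed Leibniz rule vanishes, so moving a factor x across the bracket
      changes its sign: {xz, c} = - (+/-) {z, xc}.  Moving the product xy at
      once gives one sign change and moving y, then x, gives two, hence
      2 {(xy)z, c} lies in B; and P is spanned by triple products.  So B is an
      ideal, and B = 0 or B = P.
    - If B = P, then A contains {P, P}, so it is a nonzero ideal: A = P.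
    - If B = 0, then P A = 0, and [annihilator_central] shows {P, A} = 0: for
      c in A the Leibniz rule reads {xz, c} = 2 x{z, c}, so {(xy)z, c} is both
      2 (xy){z, c} and 4 (xy){z, c}.  So A is an ideal on which the bracket
      vanishes, hence A = 0.

    If the sections are (P, P), then I is everything; if the projections are
    (0, 0), then I = 0.  In the remaining case the sections are zero and the
    projections are full, that is, I is the graph of an odd bijection phi of P
    with phi(xz) = phi(x)z.  Then phi(x)phi(z) = (-1)^|x| phi^2(xz), and
    exchanging x and z gives the same value with the opposite sign, because
    phi(x) and phi(z) have the opposite parities of x and z.  So PP = 0, which
    contradicts PP = P ([graph_mul_eq0]). *)

Set Implicit Arguments.
Unset Strict Implicit.
Unset Printing Implicit Defensive.

Import GRing.Theory.
Local Open Scope ring_scope.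
Local Open Scope classical_set_scope.

(** * Graded subspaces *)

Section GradedSubspaces.
Variables (F : fieldType) (V : superspace F).
Implicit Types (M : set V) (x y : V).

Lemma subspace0 M : subspace M -> M 0. Proof. by case. Qed.

Lemma subspaceD M x y : subspace M -> M x -> M y -> M (x + y).
Proof. by move=> [_ hM] hx hy; rewrite -[x]scale1r; apply: hM. Qed.

Lemma subspaceZ M a x : subspace M -> M x -> M (a *: x).
Proof. by move=> [h0 hM] hx; rewrite -[_ *: x]addr0; apply: hM. Qed.

Lemma subspaceB M x y : subspace M -> M x -> M y -> M (x - y).
Proof.
by move=> hM hx hy; rewrite -scaleN1r; apply: subspaceD => //; apply: subspaceZ.
Qed.

Lemma subspaceZK M a x : subspace M -> a != 0 -> M (a *: x) -> M x.
Proof.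
by move=> hM a0 /(subspaceZ a^-1 hM); rewrite scalerA mulVf ?scale1r.
Qed.

Lemma set0_subspace : subspace ([set 0] : set V).
Proof. by split=> // a x y -> ->; rewrite scaler0 addr0. Qed.

Lemma sum_comp x : (even_comp x, 0) + (0, odd_comp x) = x :> V.
Proof. by case: x => x0 x1; congr (_, _); rewrite /= ?addr0 ?add0r. Qed.

Lemma even_homog (a : even_part V) : homog false ((a, 0) : V). Proof. by []. Qed.

Lemma odd_homog (b : odd_part V) : homog true ((0, b) : V). Proof. by []. Qed.

Lemma homog_ind (Q : V -> Prop) :
  (forall x y, Q x -> Q y -> Q (x + y)) ->
  (forall i x, homog i x -> Q x) -> forall x, Q x.
Proof.
move=> QD Qh x; rewrite -[x]sum_comp.
by apply: QD; [apply: Qh (even_homog _) | apply: Qh (odd_homog _)].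
Qed.

Lemma graded_subspace_ind M (Q : V -> Prop) : graded_subspace M ->
  (forall x y, Q x -> Q y -> Q (x + y)) ->
  (forall i x, homog i x -> M x -> Q x) -> forall x, M x -> Q x.
Proof.
move=> [_ hM] QD Qh x /hM[M0 M1]; rewrite -[x]sum_comp.
by apply: QD; [apply: Qh (even_homog _) M0 | apply: Qh (odd_homog _) M1].
Qed.

(** A product commutative up to a scalar on homogeneous elements sends A x V
    into M as soon as it sends V x A into M: the supercommutative product and
    the superanticommutative bracket are the two instances. *)
Lemma absorb_sym M A (m : {bilinear V -> V -> V}) (s : bool -> bool -> F) :
  (forall i j x y, homog i x -> homog j y -> m x y = s i j *: m y x) ->
  subspace M -> graded_subspace A ->
  (forall z a, A a -> M (m z a)) -> forall a z, A a -> M (m a z).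
Proof.
move=> mC sM gA hl a z Aa; move: a Aa z.
apply: (graded_subspace_ind gA) => [a b ha hb z | i a ha Aa].
  by rewrite linearDl; apply: subspaceD.
apply: homog_ind => [x y hx hy | j z hz].
  by rewrite linearDr; apply: subspaceD.
by rewrite (mC _ _ _ _ ha hz); apply: subspaceZ => //; apply: hl.
Qed.

Lemma ksignC i j : ksign F i j = ksign F j i. Proof. by rewrite /ksign andbC. Qed.

Lemma ksignDl i j k : ksign F (i (+) j) k = ksign F i k * ksign F j k.
Proof.
by case: i j k => [] [] []; rewrite /ksign /= ?expr1 ?expr0 ?mulrNN ?mulr1 ?mul1r.
Qed.

Lemma ksignK i j : ksign F i j * ksign F i j = 1.
Proof. by rewrite /ksign; case: (i && j); rewrite /= ?expr1 ?expr0 ?mulrNN mulr1. Qed.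

End GradedSubspaces.

(** * Subspaces absorbing products and brackets *)

Section Pairs.
Variables (F : fieldType) (P : transposed_poisson F).
Hypothesis two_neq0 : (2%:R : F) != 0.
Hypothesis PP : tp_square P = setT.
Implicit Types (x y z c : P) (M A B : set P).

Local Notation "x · y" := (tp_mul P x y) (at level 40, left associativity).
Local Notation "⦃ x , y ⦄" := (tp_bracket P x y).

Lemma span_mul3 M : subspace M -> (forall x y z, M (x · y · z)) -> forall p, M p.
Proof.
move=> sM M3 p.
have PP_ind N : subspace N -> (forall x y, N (x · y)) -> forall q, N q.
  move=> sN NP q; have : tp_square P q by rewrite PP.
  by apply=> // _ [x [y ->]].
apply: (PP_ind M) => // t.
apply: (PP_ind [set t | forall z, M (t · z)]) => // {t}.
split=> [z | a x y hx hy z]; first by rewrite linear0l; exact: subspace0.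
by rewrite linearPl /=; apply: (proj2 sM).
Qed.

(** The transposed Leibniz rule has no sign depending on its last argument, so
    it extends by linearity to an arbitrary c. *)
Lemma leibniz_homog i j x z c : homog i x -> homog j z ->
  2%:R *: (x · ⦃z, c⦄) = ⦃x · z, c⦄ + ksign F i j *: ⦃z, x · c⦄.
Proof.
move=> hx hz; move: c; apply: homog_ind => [c d hc hd | k c hc].
  by rewrite !(linearDr, scalerDr) hc hd addrACA.
by have /(_ _ _ _ _ _ _ hx hz hc) := @tp_leibniz _ P.
Qed.

(** What an ideal of the Kantor double imposes both on its sections and on its
    projections ([sections_kantor_pair], [projections_kantor_pair]).  That A is
    closed under the bracket is not imposed by these ideals and has to be
    proved. *)
Record kantor_pair A B : Prop := KantorPair {
  kp_gradedA : graded_subspace A;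
  kp_gradedB : graded_subspace B;
  kp_mulAA : forall z a, A a -> A (z · a);
  kp_mulAB : forall z a, A a -> B (z · a);
  kp_mulBB : forall z b, B b -> B (z · b);
  kp_bracketBA : forall z b, B b -> A ⦃z, b⦄
}.

(** Modulo B a factor crosses the bracket with a sign change; crossing with xy
    at once and with y, then x, gives opposite signs. *)
Lemma kantor_pair_bracket A B : kantor_pair A B ->
  forall z c, B c -> B ⦃z, c⦄.
Proof.
move=> [_ [sB _] _ hAB hBB hBA] p c Bc; move: p.
have cross i j x z d : B d -> homog i x -> homog j z ->
    B (⦃x · z, d⦄ + ksign F i j *: ⦃z, x · d⦄).
  move=> Bd hx hz; rewrite -leibniz_homog //; apply: subspaceZ => //.
  by apply/hAB/hBA.
have triple i j k x y z : homog i x -> homog j y -> homog k z ->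
    B ⦃x · y · z, c⦄.
  move=> hx hy hz; have hm := @tp_mul_graded _ P.
  have := cross _ _ _ _ _ Bc (hm _ _ _ _ hx hy) hz.
  have := cross _ _ _ _ _ (hBB y _ Bc) hx hz.
  have := cross _ _ _ _ _ Bc hy (hm _ _ _ _ hx hz).
  (* both iterated brackets are rewritten to the common word x y z *)
  have -> : y · (x · z) = ksign F i j *: (x · y · z).
    by rewrite tp_mulA (tp_mulC hy hx) linearZl_LR /= ksignC.
  rewrite -[x · y · c]tp_mulA linearZl_LR /= => h1 h2 h3.
  set u := ⦃x · y · z, c⦄ in h1 h3 *.
  set v := ⦃x · z, y · c⦄ in h1 h2; set w := ⦃z, x · (y · c)⦄ in h2 h3.
  apply: (subspaceZK sB two_neq0).
  have -> : 2%:R *: u = (u + ksign F (i (+) j) k *: w)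
     - ksign F j k *: (v + ksign F i k *: w)
     + ksign F i j *: (ksign F i j *: u + ksign F j (i (+) k) *: v).
    rewrite [ksign F j (_ (+) _)]ksignC !ksignDl [ksign F k j]ksignC.
    rewrite !scalerDr !scalerA mulrA ksignK mul1r scale1r.
    rewrite [ksign F j k * _]mulrC opprD [- _ - _]addrC [_ + (- _ - _)]addrA addrK addrACA.
    by rewrite addNr addr0 scaler_nat mulr2n.
  by apply: subspaceD => //; [apply: subspaceB => // |]; apply: subspaceZ.
apply: span_mul3 => [|x y z].
  split=> [|a x y hx hy]; first by rewrite linear0l; exact: subspace0.
  by rewrite linearPl; apply: (proj2 sB).
elim/homog_ind: x => [x x' hx hx' | i x hx].
  by rewrite !linearDl; apply: subspaceD.
elim/homog_ind: y => [y y' hy hy' | j y hy].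
  by rewrite linearDr !linearDl; apply: subspaceD.
elim/homog_ind: z => [z z' hz hz' | k z hz].
  by rewrite linearDr linearDl; apply: subspaceD.
exact: triple hx hy hz.
Qed.

(** Here a factor leaves the bracket with the coefficient 2, so xy leaves with
    the coefficient 2 at once and with 4 in two steps. *)
Lemma annihilator_central c : (forall z, z · c = 0) -> forall z, ⦃z, c⦄ = 0.
Proof.
move=> hc.
have out x z : ⦃x · z, c⦄ = 2%:R *: (x · ⦃z, c⦄).
  elim/homog_ind: x => [x x' hx hx' | i x hx].
    by rewrite !linearDl hx hx' -scalerDr.
  elim/homog_ind: z => [z z' hz hz' | j z hz].
    by rewrite linearDr !linearDl hz hz' -scalerDr -linearDr.
  by rewrite (leibniz_homog _ hx hz) hc linear0r scaler0 addr0.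
apply: (@span_mul3 [set z | ⦃z, c⦄ = 0]) => [|x y z] /=.
  split=> [|a x y hx hy] /=; first exact: linear0l.
  by rewrite linearPl hx hy scaler0 addr0.
have twice := out (x · y) z; have := twice.
rewrite -{1}tp_mulA out out linearZr tp_mulA /= => /(scalerI two_neq0) /eqP.
rewrite scaler_nat mulr2n -subr_eq0 addrK => /eqP e0.
by rewrite twice e0 scaler0.
Qed.

Hypothesis Psimple : simple_transposed_poisson P.
Hypothesis bracket_neq0 : exists x y : P, ⦃x, y⦄ <> 0.

Lemma left_ideal_trivial M : graded_subspace M ->
  (forall z x, M x -> M (z · x)) -> (forall z x, M x -> M ⦃z, x⦄) ->
  M = [set 0] \/ M = setT.
Proof.
move=> gM hm hb; apply: Psimple; split=> // x y Mx; split.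
  by apply: (absorb_sym (@tp_mulC _ P)) Mx => //; case: gM.
apply: (@absorb_sym _ _ M M _ (fun i j => - ksign F i j)) Mx => //; last by case: gM.
by move=> i j a b ha hb'; rewrite scaleNr; apply: tp_bracketC.
Qed.

Lemma kantor_pair_trivial A B : kantor_pair A B ->
  (A = [set 0] /\ B = [set 0]) \/ (A = setT /\ B = setT).
Proof.
move=> AB; have hBB := kantor_pair_bracket AB.
have [x0 [y0 xy0]] := bracket_neq0.
case: AB hBB => gA gB hAA hAB mBB hBA hBB.
have [B0|BT] := left_ideal_trivial gB mBB hBB; [left|right]; split=> //.
  have central z a : A a -> ⦃z, a⦄ = 0.
    move=> Aa; apply: annihilator_central => t.
    by have := hAB t a Aa; rewrite B0.
  have [z a Aa|//|AT] := left_ideal_trivial gA hAA; last first.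
    by case: xy0; apply: central; rewrite AT.
  by rewrite central //; exact: subspace0 (proj1 gA).
have bA z a : A ⦃z, a⦄ by apply: hBA; rewrite BT.
have [A0|//] := left_ideal_trivial gA hAA (fun z a _ => bA z a).
by have := bA x0 y0; rewrite A0.
Qed.

End Pairs.

(** * Ideals of the Kantor double *)

Section KantorIdeals.
Variables (F : fieldType) (P : transposed_poisson F).
Variable I : set (kantor_double P).
Hypothesis idI : graded_ideal I.
Implicit Types x y z w : P.

Local Notation "x · y" := (tp_mul P x y) (at level 40, left associativity).
Local Notation "⦃ x , y ⦄" := (tp_bracket P x y).

(** The ideal read as a relation on P; it is compared with the graph of a
    linear map in [graph_mul_eq0]. *)
Definition kantor_rel x y : Prop := I (kin x + kshift y).
Local Notation R := kantor_rel.

Lemma kantor_relE u : R (kfst u) (ksnd u) = I u.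
Proof. by rewrite /kantor_rel -kantor_decomp. Qed.

Lemma kantor_rel0 : R 0 0.
Proof. by rewrite /kantor_rel !linear0 addr0; case: idI => -[[]]. Qed.

Lemma kantor_relP a x y x' y' :
  R x y -> R x' y' -> R (a *: x + x') (a *: y + y').
Proof.
rewrite /kantor_rel => h h'; rewrite kin_linear kshift_linear addrACA -scalerDr.
by case: idI => -[[_ sI] _] _; apply: sI.
Qed.

Lemma kantor_relZ a x y : R x y -> R (a *: x) (a *: y).
Proof. by move=> h; have := kantor_relP a h kantor_rel0; rewrite !addr0. Qed.

Lemma kantor_relB x y x' y' : R x y -> R x' y' -> R (x' - x) (y' - y).
Proof. by move=> h /(kantor_relP (-1) h); rewrite !scaleN1r ![- _ + _]addrC. Qed.

Lemma kantor_rel_comp x y : R x y ->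
  R (even_comp x, 0) (0, odd_comp y) /\ R (0, odd_comp x) (even_comp y, 0).
Proof.
case: idI => -[_ gI] _ /gI; rewrite /kantor_rel.
have -> : (even_comp (kin x + kshift y), 0) =
    kin ((even_comp x, 0) : P) + kshift ((0, odd_comp y) : P).
  by congr (_, _); congr (_, _); rewrite /= ?addr0 ?add0r.
have -> : (0, odd_comp (kin x + kshift y)) =
    kin ((0, odd_comp x) : P) + kshift ((even_comp y, 0) : P).
  by congr (_, _); congr (_, _); rewrite /= ?addr0 ?add0r.
by [].
Qed.

Lemma parity_autK x : parity_aut (parity_aut x) = x.
Proof. by case: x => x0 x1; congr (_, _); rewrite /= opprK. Qed.

Lemma kantor_relMl z x y : R x y -> R (z · x) (parity_aut z · y).
Proof.
move=> /(proj2 idI _ (kin z)) [_]; rewrite /= /kantor_rel /kantor_mul.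
by rewrite !linearD /= !kE !(linear0, linear0l, linear0r, addr0, add0r).
Qed.

Lemma kantor_relMr z x y : R x y -> R (x · z) (y · z).
Proof.
move=> /(proj2 idI _ (kin z)) [+ _]; rewrite /= /kantor_rel /kantor_mul.
by rewrite !linearD /= !kE !(linear0, linear0l, linear0r, addr0, add0r).
Qed.

Lemma kantor_relSl z x y : R x y -> R ⦃parity_aut z, y⦄ (z · x).
Proof.
move=> /(proj2 idI _ (kshift z)) [_]; rewrite /= /kantor_rel /kantor_mul.
by rewrite !linearD /= !kE !(linear0, linear0l, linear0r, addr0, add0r).
Qed.

(** Left factors are replaced by their images under the involution
    [parity_aut] where the product of the double introduces a sign. *)
Lemma sections_kantor_pair : kantor_pair [set x | R x 0] [set y | R 0 y].
Proof.
split=> [||z a|z a|z b|z b] /=.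
- split=> [|x /kantor_rel_comp[] //]; split=> [|a x y hx hy].
    exact: kantor_rel0.
  by have := kantor_relP a hx hy; rewrite scaler0 addr0.
- split=> [|x /kantor_rel_comp[] //]; split=> [|a x y hx hy].
    exact: kantor_rel0.
  by have := kantor_relP a hx hy; rewrite scaler0 addr0.
- by move=> /(kantor_relMl z); rewrite linear0r.
- by move=> /(kantor_relSl z); rewrite linear0r.
- by move=> /(kantor_relMl (parity_aut z)); rewrite linear0r parity_autK.
- by move=> /(kantor_relSl (parity_aut z)); rewrite linear0r parity_autK.
Qed.

Lemma projections_kantor_pair :
  kantor_pair [set x | exists y, R x y] [set y | exists x, R x y].
Proof.
split=> [||z a|z a|z b|z b] /=.
- split=> [|x [y /kantor_rel_comp[h0 h1]]]; last by split; eexists; eassumption.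
  split=> [|a x y [x' hx] [y' hy]]; first by exists 0; exact: kantor_rel0.
  by exists (a *: x' + y'); exact: kantor_relP.
- split=> [|x [y /kantor_rel_comp[h0 h1]]]; last by split; eexists; eassumption.
  split=> [|a x y [x' hx] [y' hy]]; first by exists 0; exact: kantor_rel0.
  by exists (a *: x' + y'); exact: kantor_relP.
- by move=> [y /(kantor_relMl z)]; eexists; eassumption.
- by move=> [y /(kantor_relSl z)]; eexists; eassumption.
- move=> [x /(kantor_relMl (parity_aut z))].
  by rewrite parity_autK; eexists; eassumption.
- move=> [x /(kantor_relSl (parity_aut z))].
  by rewrite parity_autK; eexists; eassumption.
Qed.

Hypothesis two_neq0 : (2%:R : F) != 0.
Hypothesis inj_l : forall x, R x 0 -> x = 0.
Hypothesis inj_r : forall y, R 0 y -> y = 0.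
Hypothesis total_l : forall x, exists y, R x y.

Lemma kantor_rel_uniq x y y' : R x y -> R x y' -> y = y'.
Proof.
move=> h /kantor_relB /(_ h); rewrite subrr => /inj_r /eqP.
by rewrite subr_eq0 => /eqP.
Qed.

Lemma kantor_rel_homog i x y : homog i x -> R x y -> homog (~~ i) y.
Proof.
move=> hx /kantor_rel_comp[]; case: i hx; rewrite /homog /= => ->.
  by move=> /inj_r[].
by move=> _ /inj_r[].
Qed.

(** Writing phi for the map with graph R, phi(x)phi(z) = (-1)^|x| phi^2(xz)
    since phi(xz) is both phi(x)z and (-1)^|x| x phi(z). *)
Lemma kantor_rel_mul i x y z w v : homog i x -> R x y -> R z w ->
  R (y · z) v -> y · w = (-1) ^+ i *: v.
Proof.
move=> hx hxy hzw hv.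
have e : y · z = (-1) ^+ i *: (x · w).
  apply: (kantor_rel_uniq (kantor_relMr z hxy)).
  by have := kantor_relMl x hzw; rewrite (parity_aut_homog hx) linearZl_LR.
have := kantor_relZ ((-1) ^+ i) (kantor_relMr w hxy); rewrite -e => hv'.
by rewrite (kantor_rel_uniq hv hv') scalerA -signr_addb addbb expr0 scale1r.
Qed.

(** Exchanging the factors of phi(x)phi(z) costs (-1)^((|x|+1)(|z|+1)), and
    those of phi^2(xz) only (-1)^(|x||z|): the two values of phi(x)phi(z) have
    opposite signs. *)
Lemma graph_mul_eq0 x z : x · z = 0.
Proof.
elim/homog_ind: x => [x x' hx hx' | i x hx].
  by rewrite linearDl hx hx' addr0.
elim/homog_ind: z => [z z' hz hz' | j z hz].
  by rewrite linearDr hz hz' addr0.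
have [[y hy] [w hw]] := (total_l x, total_l z).
have [[v hv] [v' hv']] := (total_l (y · z), total_l (w · x)).
have yw := kantor_rel_mul hx hy hw hv.
have wy := kantor_rel_mul hz hw hy hv'.
have hyz := kantor_relMr z hy.
have wx : w · x = ksign F i j *: (y · z).
  apply: (kantor_rel_uniq (kantor_relMr x hw)).
  by rewrite ksignC (tp_mulC hz hx) ksignC; apply: kantor_relZ.
have v'E : v' = ksign F i j *: v.
  by apply: kantor_rel_uniq hv' _; rewrite wx; apply: kantor_relZ.
have v0 : v = 0.
  have := tp_mulC (kantor_rel_homog hx hy) (kantor_rel_homog hz hw).
  rewrite yw wy v'E !scalerA => e.
  apply: (scalerI two_neq0); rewrite scaler0 scaler_nat mulr2n.
  move: e; rewrite /ksign.
  by case: i {hx v'E wx yw}; case: j {hz wy};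
     rewrite /= ?expr1 ?expr0 ?(mulrNN, mulr1, mul1r) ?(scaleN1r, scale1r) => e;
     [rewrite -{1}e | rewrite -{1}e | rewrite {1}e | rewrite {1}e]; rewrite addNr.
rewrite v0 in hv; have yz0 := inj_l hv.
by rewrite yz0 in hyz; apply: inj_l.
Qed.

End KantorIdeals.

Theorem theorem27 (F : fieldType) (hF : 2%N \notin [pchar F])
    (P : transposed_poisson F)
    (Psimple : simple_transposed_poisson P)
    (bracket_neq0 : exists x y : P, tp_bracket P x y <> 0)
    (PP : tp_square P = setT) :
  simple_superalgebra (kantor_double P).
Proof.
have two_neq0 : (2%:R : F) != 0 by move: hF; rewrite inE.
move=> I idI.
have pair := kantor_pair_trivial two_neq0 PP Psimple bracket_neq0.
have [[A0 B0]|[AT BT]] := pair _ _ (sections_kantor_pair idI); last first.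
  right; apply/seteqP; split=> // u _; rewrite -kantor_relE.
  have hA : [set x | kantor_rel I x 0] (kfst u) by rewrite AT.
  have hB : [set y | kantor_rel I 0 y] (ksnd u) by rewrite BT.
  by have := kantor_relP idI 1 hA hB; rewrite !scale1r addr0 add0r.
have [[A0' B0']|[AT' _]] := pair _ _ (projections_kantor_pair idI).
  left; apply/seteqP; split=> u /=; last first.
    by move=> ->; exact: subspace0 (proj1 (proj1 idI)).
  rewrite -kantor_relE => h; rewrite [u]kantor_decomp.
  have : [set x | exists y, kantor_rel I x y] (kfst u) by exists (ksnd u).
  have : [set y | exists x, kantor_rel I x y] (ksnd u) by exists (kfst u).
  by rewrite A0' B0' => -> ->; rewrite !linear0 addr0.
exfalso; have mul0 : forall x z : P, tp_mul P x z = 0.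
  apply: (graph_mul_eq0 idI two_neq0) => [x h|y h|x].
  - by have : [set x | kantor_rel I x 0] x by []; rewrite A0.
  - by have : [set y | kantor_rel I 0 y] y by []; rewrite B0.
  - by have : [set x | exists y, kantor_rel I x y] x by rewrite AT'.
have [x [y]] := bracket_neq0; apply.
apply: (span_mul3 PP (set0_subspace P)) => a b c /=; exact: mul0.
Qed.
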